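(* Let $G=(V,\sigma,\mu)$ be a fuzzy graph of order $p$ such that $G$ and its complement $\overline{G}$ are both non-trivial. Then $$2(\mu_{\min}+\overline{\mu}_{\min})\le \gamma_{snR}(G)+\gamma_{snR}(\overline{G})<2p,$$ where $\mu_{\min}$ and $\overline{\mu}_{\min}$ are the minimum weights of a strong edge in $G$ and in $\overline{G}$, respectively.
   Context: A fuzzy graph $G=(V,\sigma,\mu)$ consists of a finite nonempty set $V$, a function $\sigma:V\to[0,1]$, and a symmetric function $\mu:V\times V\to[0,1]$ with $\mu(x,x)=0$ and $\mu(x,y)\le \min\{\sigma(x),\sigma(y)\}$ for all $x,y\in V$. Its order is $p=\sum_{x\in V}\sigma(x)$. The complement is $\overline{G}=(V,\sigma,\overline{\mu})$ with $\overline{\mu}(x,y)=\min\{\sigma(x),\sigma(y)\}-\mu(x,y)$ for distinct $x,y\in V$ and $\overline{\mu}(x,x)=0$. An edge is an unordered pair $(u,v)$ of distinct vertices with $\mu(u,v)>0$, and $\mu(u,v)$ is its weight. A fuzzy graph is non-trivial if it has at least one edge. The strength of a path $x_0,x_1,\ldots,x_m$ (with every $\mu(x_{i-1},x_i)>0$) is $\min_i \mu(x_{i-1},x_i)$, and $CONN_G(u,v)$ is the maximum strength of all $u$–$v$ paths. An edge $(u,v)$ is strong if $\mu(u,v)=CONN_G(u,v)$; then $u,v$ are strong neighbors. $N_s(u)$ is the set of strong neighbors of $u$. Put $\mu_s(u)=\min\{\mu(u,v):v\in N_s(u)\}$, with $\mu_s(u)=0$ if $N_s(u)=\emptyset$.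 A strong-neighbors Roman dominating function (SNRDF) on $G$ is a function $f:V\to\{0,1,2\}$ such that every $u$ with $f(u)=0$ has some $v\in N_s(u)$ with $f(v)=2$. Its weight is $w(f)=\sum_{u\in V}f(u)\mu_s(u)$, and $\gamma_{snR}(G)$ is the minimum weight of an SNRDF on $G$. *)

(* Defs.v *)
From HB Require Import structures.
From mathcomp Require Import all_boot all_order all_algebra.

Set Implicit Arguments.
Unset Strict Implicit.
Unset Printing Implicit Defensive.

Import Order.TTheory GRing.Theory Num.Theory.
Local Open Scope ring_scope.

Record fuzzyGraph (R : realFieldType) (V : finType) := FuzzyGraph {
  fsigma : V -> R;
  fmu : V -> V -> R;
  fg_nonempty : (0 < #|V|)%N;
  fsigma_itv : forall x, 0 <= fsigma x <= 1;
  fmu_itv : forall x y, 0 <= fmu x y <= 1;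
  fmu_sym : forall x y, fmu x y = fmu y x;
  fmu_irr : forall x, fmu x x = 0;
  fmu_le : forall x y, fmu x y <= Num.min (fsigma x) (fsigma y)
}.

Section FuzzyGraph.
Variables (R : realFieldType) (V : finType).
Implicit Types (G : fuzzyGraph R V) (u v x y : V).

Definition order_fg G : R := \sum_x fsigma G x.

Definition cmu G x y : R :=
  if x == y then 0 else Num.min (fsigma G x) (fsigma G y) - fmu G x y.

Fact cmu_itv G x y : 0 <= cmu G x y <= 1.
Proof.
rewrite /cmu; case: eqP => _; first by rewrite lexx ler01.
rewrite subr_ge0 fmu_le /= lerBlDr.
have /andP[_ sx1] := fsigma_itv G x; have /andP[m0 _] := fmu_itv G x y.
by rewrite (le_trans (y := 1)) ?ge_min ?sx1 // lerDl.
Qed.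

Fact cmu_sym G x y : cmu G x y = cmu G y x.
Proof. by rewrite /cmu eq_sym minC fmu_sym. Qed.

Fact cmu_irr G x : cmu G x x = 0.
Proof. by rewrite /cmu eqxx. Qed.

Fact cmu_le G x y : cmu G x y <= Num.min (fsigma G x) (fsigma G y).
Proof.
rewrite /cmu; case: eqP => _.
  have /andP[sx _] := fsigma_itv G x; have /andP[sy _] := fsigma_itv G y.
  by rewrite le_min sx sy.
by have /andP[m0 _] := fmu_itv G x y; rewrite gerBl.
Qed.

Definition complement G : fuzzyGraph R V :=
  FuzzyGraph (fg_nonempty G) (fsigma_itv G) (cmu_itv G) (cmu_sym G)
    (cmu_irr G) (cmu_le G).

Definition fedge G u v : bool := (u != v) && (0 < fmu G u v).

Definition nontrivial G : Prop := exists u v, fedge G u v.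

(* u :: p is a u-v path; paths have pairwise distinct vertices, which also
   bounds the size of p and makes the maximum in [conn] a finite one. *)
Definition is_fpath G u v (p : seq V) : bool :=
  [&& path (fedge G) u p, last u p == v & uniq (u :: p)].

(* Default values of the iterated min and max below: all weights lie in
   [0, 1], so 1 is neutral for min and 0 is neutral for max; the values on
   empty ranges play no role. *)
Definition strength G u (p : seq V) : R :=
  \big[Num.min/1]_(w <- pairmap (fmu G) u p) w.

Definition conn G u v : R :=
  \big[Num.max/0]_(p : #|V|.-bseq V | is_fpath G u v p) strength G u p.

Definition strong G u v : bool := fedge G u v && (fmu G u v == conn G u v).

Definition strong_nbrs G u : {set V} := [set v | strong G u v].

Definition mu_s G u : R :=
  if strong_nbrs G u == set0 then 0
  else \big[Num.min/1]_(v in strong_nbrs G u) fmu G u v.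

Definition mu_min G : R :=
  \big[Num.min/1]_(e : V * V | strong G e.1 e.2) fmu G e.1 e.2.

Definition snrdf G (f : {ffun V -> 'I_3}) : bool :=
  [forall u, (f u == 0%N :> nat) ==>
    [exists v in strong_nbrs G u, f v == 2%N :> nat]].

Definition snr_weight G (f : {ffun V -> 'I_3}) : R :=
  \sum_u (f u)%:R * mu_s G u.

(* The constant function 1 is an SNRDF, so this is a genuine minimum. *)
Definition gamma_snR G : R :=
  snr_weight G
    [arg min_(f < [ffun=> inord 1%N] | snrdf G f) snr_weight G f]%O.

Fact snrdf_const1 G : snrdf G [ffun=> inord 1%N].
Proof. by apply/forallP => u; rewrite ffunE inordK. Qed.

End FuzzyGraph.

(* Main.v *)
Require Import Defs.
From HB Require Import structures.
From mathcomp Require Import all_boot all_order all_algebra.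
From mathcomp Require Import lra.

Set Implicit Arguments.
Unset Strict Implicit.
Unset Printing Implicit Defensive.

Import Order.TTheory GRing.Theory Num.Theory.
Local Open Scope ring_scope.

(** A heaviest edge across a cut is strong, since every path across the cut
    uses an edge of the cut. Hence every non-isolated vertex has a strong
    neighbor, which yields the lower bound.

    The constant function 1 gives [gamma_snR G <= \sum_u mu_s G u <= p]. If both
    sums of the upper bound were tight, then [mu_s u = sigma u] in [G] and in
    its complement, for all [u]. Take [u] with [sigma u > 0], a strong neighbor
    [v] in [G] and a strong neighbor [w] in the complement; all three have the
    same [sigma]. The pair [v w] is an edge of [G] or of the complement, so it
    crosses the cut around the strong edge [u v] of [G], or around the strong
    edge [u w] of the complement. A heaviest edge of that cut is strong, which
    produces a vertex [a] with two strong neighbors, all with the same [mu_s];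
    assigning 2 to [a], 0 to the neighbors and 1 elsewhere beats the constant
    function 1. *)

Section FuzzyGraphTheory.
Variables (R : realFieldType) (V : finType) (G : fuzzyGraph R V).
Implicit Types (u v x y a b c : V) (A : {set V}).

Lemma fmu_ge0 x y : 0 <= fmu G x y.
Proof. by case/andP: (fmu_itv G x y). Qed.

Lemma fsigma_ge0 x : 0 <= fsigma G x.
Proof. by case/andP: (fsigma_itv G x). Qed.

Lemma fmu_lel x y : fmu G x y <= fsigma G x.
Proof. by have := fmu_le G x y; rewrite le_min => /andP[]. Qed.

Lemma fmu_ler x y : fmu G x y <= fsigma G y.
Proof. by rewrite fmu_sym fmu_lel. Qed.

Lemma fedge_sym u v : fedge G u v = fedge G v u.
Proof. by rewrite /fedge eq_sym fmu_sym. Qed.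

Lemma fedgeE u v : fedge G u v = (0 < fmu G u v).
Proof. by rewrite /fedge; case: eqP => // ->; rewrite fmu_irr ltxx. Qed.

Lemma strong_fedge u v : strong G u v -> fedge G u v.
Proof. by case/andP. Qed.

(** * Cuts and strong edges *)

Lemma strength_cut A u v p (w : R) : u \in A -> v \notin A -> last u p = v ->
    (forall x y, x \in A -> y \notin A -> fmu G x y <= w) ->
  strength G u p <= w.
Proof.
move=> + vA + cut; rewrite /strength.
elim: p u => [|x p IHp] u uA /= lastp; first by rewrite -lastp uA in vA.
rewrite big_cons ge_min; have [xA|xA] := boolP (x \in A).
  by rewrite IHp ?orbT.
by rewrite cut.
Qed.

Lemma conn_cut A u v (w : R) : 0 <= w -> u \in A -> v \notin A ->
    (forall x y, x \in A -> y \notin A -> fmu G x y <= w) ->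
  conn G u v <= w.
Proof.
move=> w0 uA vA cut; apply/bigmax_leP; split=> // p /and3P[_ /eqP lastp _].
exact: strength_cut lastp cut.
Qed.

Lemma fmu_le_conn u v : fedge G u v -> fmu G u v <= conn G u v.
Proof.
(* The one-edge path is a candidate in the maximum: its size 1 fits the bound since [V] is
   nonempty. *)
move=> uv; have V1 : (size [:: v] <= #|V|)%N := fg_nonempty G.
have path_uv : is_fpath G u v (Bseq V1).
  by rewrite /is_fpath /= uv eqxx inE; case/andP: uv => ->.
have := @le_bigmax_cond _ _ _ 0 (Bseq V1) (fun p => is_fpath G u v p)
  (fun p => strength G u p) path_uv.
by rewrite /strength /= big_cons big_nil min_l //; case/andP: (fmu_itv G u v).
Qed.

Lemma strong_cut A u v : fedge G u v -> u \in A -> v \notin A ->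
    (forall x y, x \in A -> y \notin A -> fmu G x y <= fmu G u v) ->
  strong G u v.
Proof.
move=> uv uA vA cut; rewrite /strong uv eq_le fmu_le_conn //=.
by rewrite (conn_cut _ uA vA cut) ?fmu_ge0.
Qed.

(** The reverse orientation comes from the same cut seen from [~: A], so no path has to be
    reversed. *)
Lemma strong_cross A u v : fedge G u v -> u \in A -> v \notin A ->
  exists a b, [/\ a \in A, b \notin A, strong G a b & strong G b a].
Proof.
move=> uv uA vA.
pose P (e : V * V) := (e.1 \in A) && (e.2 \notin A).
have P0 : P (u, v) by rewrite /P /= uA.
case: (@Order.TotalTheory.arg_maxP _ _ _ (u, v) P (fun e => fmu G e.1 e.2) P0).
move=> [a b] /andP[/= aA bA] max_ab; have cut x y : x \in A -> y \notin A ->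
    fmu G x y <= fmu G a b.
  by move=> xA yA; apply: (max_ab (x, y)); rewrite /P /= xA.
have ab : fedge G a b.
  by move: uv; rewrite !fedgeE => /lt_le_trans; apply; apply: cut.
exists a, b; split=> //; first exact: strong_cut cut.
apply: (@strong_cut (~: A)); rewrite ?inE 1?fedge_sym ?negbK //.
by move=> x y; rewrite !inE negbK fmu_sym [fmu G b a]fmu_sym => xA yA; apply: cut.
Qed.

(** * Bounds on [mu_s] *)

Lemma mu_s_le u v : strong G u v -> mu_s G u <= fmu G u v.
Proof.
move=> uv; have uv' : v \in strong_nbrs G u by rewrite inE.
rewrite /mu_s ifN; first exact: bigmin_le_cond.
by apply/set0Pn; exists v.
Qed.

Lemma mu_s_gt0P u : 0 < mu_s G u -> exists v, strong G u v.
Proof.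
rewrite /mu_s; case: ifPn => [_|/set0Pn[v]]; first by rewrite ltxx.
by rewrite inE; exists v.
Qed.

Lemma mu_s_ge0 u : 0 <= mu_s G u.
Proof.
rewrite /mu_s; case: ifP => // _.
by apply/bigmin_geP; split=> // v _; apply: fmu_ge0.
Qed.

Lemma mu_s_le_fsigma u : mu_s G u <= fsigma G u.
Proof.
have [/mu_s_gt0P[v /mu_s_le uv]|/le_trans] := ltP 0 (mu_s G u).
  exact: le_trans uv (fmu_lel u v).
by apply; apply: fsigma_ge0.
Qed.

Lemma mu_min_le_mu_s u v : fedge G u v -> mu_min G <= mu_s G u.
Proof.
move=> uv; have vu : v \notin [set u] by rewrite inE eq_sym; case/andP: uv.
(* The cut around [u] alone yields a strong neighbor, so [mu_s G u] is not the default 0. *)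
have [a [b [/set1P-> _ ub _]]] := strong_cross uv (set11 u) vu.
rewrite /mu_s ifN; last by apply/set0Pn; exists b; rewrite inE.
apply/bigmin_geP; split; first exact: bigmin_le_id.
move=> x; rewrite inE => ux.
exact: (@bigmin_le_cond _ _ _ 1 (u, x) (fun e => strong G e.1 e.2)
  (fun e => fmu G e.1 e.2)).
Qed.

(** * Bounds on [gamma_snR] *)

Lemma gamma_snR_attained :
  exists2 f, snrdf G f & gamma_snR G = snr_weight G f.
Proof.
rewrite /gamma_snR.
by case: Order.TotalTheory.arg_minP => [|f sf _]; [exact: snrdf_const1|exists f].
Qed.

Lemma gamma_snR_le f : snrdf G f -> gamma_snR G <= snr_weight G f.
Proof.
rewrite /gamma_snR => sf; case: Order.TotalTheory.arg_minP => [|g _]; last exact.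
exact: snrdf_const1.
Qed.

Lemma gamma_snR_le_sum : gamma_snR G <= \sum_u mu_s G u.
Proof.
apply: le_trans (gamma_snR_le (snrdf_const1 G)) _.
by apply: ler_sum => u _; rewrite ffunE inordK // mul1r.
Qed.

Lemma sum_mu_s_le_order : \sum_u mu_s G u <= order_fg G.
Proof. by apply: ler_sum => u _; apply: mu_s_le_fsigma. Qed.

(** If [f] vanishes somewhere, a vertex of value 2 contributes enough alone; otherwise [f] is at
    least 1 and both ends of an edge contribute [mu_min G]. *)
Lemma gamma_snR_ge : nontrivial G -> 2 * mu_min G <= gamma_snR G.
Proof.
move=> [x [y xy]]; have [f sf ->] := gamma_snR_attained.
have term_ge0 u : 0 <= (f u)%:R * mu_s G u by rewrite mulr_ge0 ?mu_s_ge0.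
have [/existsP[u fu0]|/existsPn fN0] := boolP [exists u, f u == 0%N :> nat].
  have /existsP[v /andP[]] := implyP (forallP sf u) fu0.
  rewrite inE => /strong_fedge uv /eqP fv2.
  rewrite /snr_weight (bigD1 v) //= fv2 -[leLHS]addr0.
  apply: lerD; last exact: sumr_ge0.
  by rewrite ler_pM2l // (@mu_min_le_mu_s v u) // fedge_sym.
have f_ge1 u : mu_s G u <= (f u)%:R * mu_s G u.
  by rewrite ler_peMl ?mu_s_ge0 // ler1n lt0n.
have yx : y != x by rewrite eq_sym; case/andP: xy.
have mx := le_trans (mu_min_le_mu_s xy) (f_ge1 x).
have my : mu_min G <= (f y)%:R * mu_s G y.
  by apply: le_trans (f_ge1 y); apply: (@mu_min_le_mu_s y x); rewrite fedge_sym.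
rewrite /snr_weight (bigD1 x) //= (bigD1 y) //=.
have : 0 <= \sum_(i | (i != x) && (i != y)) (f i)%:R * mu_s G i by apply: sumr_ge0.
by lra.
Qed.

(** Moving the values of [b] and [c] to [a] changes the weight of the constant 1 by
    [mu_s G a - mu_s G b - mu_s G c]. *)
Lemma gamma_snR_lt_sum a b c : b != c -> strong G b a -> strong G c a ->
  mu_s G a < mu_s G b + mu_s G c -> gamma_snR G < \sum_u mu_s G u.
Proof.
move=> bc ba ca lt_abc.
have /andP[neq_ba _] := strong_fedge ba; have /andP[neq_ca _] := strong_fedge ca.
pose f : {ffun V -> 'I_3} := [ffun x => inord
  (if x == a then 2 else if (x == b) || (x == c) then 0 else 1)].
have fE x : f x = (if x == a then 2 else if (x == b) || (x == c) then 0 else 1)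
    :> nat.
  by rewrite ffunE inordK //; do 2?case: ifP.
have sf : snrdf G f.
  apply/forallP => x; apply/implyP; rewrite fE; case: ifP => // _.
  case: ifP => // xbc _; apply/existsP; exists a; rewrite fE eqxx andbT inE.
  by case/orP: xbc => /eqP->.
have sumD (F : V -> R) : \sum_x F x =
    F a + (F b + (F c + \sum_(x | (x != a) && (x != b) && (x != c)) F x)).
  rewrite (bigD1 a) //= (bigD1 b) //= (bigD1 (P := fun i => _ && _) c) //=.
  by rewrite neq_ca eq_sym.
apply: le_lt_trans (gamma_snR_le sf) _; rewrite /snr_weight !sumD.
rewrite !fE !eqxx (negPf neq_ba) (negPf neq_ca) orbT !mul0r !add0r.
rewrite [X in _ + X < _](eq_bigr (mu_s G)).
  by move: lt_abc; lra.
move=> x /andP[/andP[xa xb] xc].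
by rewrite fE (negPf xa) (negPf xb) (negPf xc) mul1r.
Qed.

Section Tight.
Hypothesis tight : forall u, mu_s G u = fsigma G u.

(** The weight of [u v] lies between [mu_s G u] and [fsigma G u], hence equals both. No edge at [u]
    is heavier, so the cut around [u] makes [v u] strong, and the same squeeze applies at [v]. *)
Lemma tight_strong u v : strong G u v ->
  [/\ fmu G u v = fsigma G u, fsigma G v = fsigma G u & strong G v u].
Proof.
move=> uv; have fmu_uv : fmu G u v = fsigma G u.
  by apply/eqP; rewrite eq_le fmu_lel -tight mu_s_le.
have neq_uv : u != v by case/andP: (strong_fedge uv).
have vu : strong G v u.
  apply: (@strong_cut [set~ u]); rewrite ?inE ?eqxx // 1?eq_sym //.
    by rewrite fedge_sym strong_fedge.
  by move=> x y _; rewrite !inE negbK [fmu G v u]fmu_sym fmu_uv => /eqP->; apply: fmu_ler.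
split=> //; apply/eqP; rewrite eq_le -{1}tight -fmu_uv fmu_ler andbT.
by rewrite fmu_sym mu_s_le.
Qed.

Lemma tight_gamma_snR_lt u v w : strong G u v -> fedge G v w -> w != u ->
  gamma_snR G < order_fg G.
Proof.
move=> uv vw wu; have [_ svu vu] := tight_strong uv.
have wv : w != v by rewrite eq_sym; case/andP: vw.
have wA : w \notin [set u; v] by rewrite !inE negb_or wu.
have [a [b [aA bA ab ba]]] := strong_cross vw (set22 u v) wA.
have [fmu_ab sba _] := tight_strong ab.
have : 0 < fsigma G a by rewrite -fmu_ab -fedgeE strong_fedge.
move: bA; rewrite !inE negb_or => /andP[bu bv] a_gt0.
apply: lt_le_trans sum_mu_s_le_order.
(* The center [a] has two strong neighbors: [b] and the other end of [u v]. *)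
case/set2P: aA => ea; subst a.
  by apply: (gamma_snR_lt_sum bv ba vu); rewrite !tight; lra.
by apply: (gamma_snR_lt_sum bu ba uv); rewrite !tight; lra.
Qed.

End Tight.

Lemma order_tight : order_fg G <= gamma_snR G ->
  forall u, mu_s G u = fsigma G u.
Proof.
move=> le_og u; have le_os := le_trans le_og gamma_snR_le_sum.
apply/eqP; rewrite eq_le mu_s_le_fsigma /=; move: le_os.
rewrite /order_fg (bigD1 u) //= [leRHS](bigD1 u) //=.
have : \sum_(i | i != u) mu_s G i <= \sum_(i | i != u) fsigma G i.
  by apply: ler_sum => i _; apply: mu_s_le_fsigma.
by lra.
Qed.

End FuzzyGraphTheory.

(** * A graph and its complement together *)

Lemma gamma_snR_complement_lt (R : realFieldType) (V : finType)
    (G : fuzzyGraph R V) : nontrivial G ->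
  gamma_snR G + gamma_snR (complement G) < 2 * order_fg G.
Proof.
move=> [u [x ux]].
have le1 := le_trans (gamma_snR_le_sum G) (sum_mu_s_le_order G).
have le2 : gamma_snR (complement G) <= order_fg G :=
  le_trans (gamma_snR_le_sum (complement G)) (sum_mu_s_le_order (complement G)).
have [lt1|/order_tight t1] := ltP (gamma_snR G) (order_fg G); first by lra.
have [lt2|/(@order_tight _ _ (complement G)) t2] :=
  ltP (gamma_snR (complement G)) (order_fg G); first by lra.
have u_gt0 : 0 < fsigma G u.
  by move: ux; rewrite fedgeE => /lt_le_trans; apply; apply: fmu_lel.
have [v uv] : exists v, strong G u v by apply: mu_s_gt0P; rewrite t1.
have [w uw] : exists w, strong (complement G) u w.
  by apply: mu_s_gt0P; rewrite t2.
have [fmu_uv sv vu] := tight_strong t1 uv.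
have [cmu_uw /= sw wu] := tight_strong t2 uw.
have /andP[neq_uv _] := strong_fedge uv.
have /andP[neq_uw _] := strong_fedge uw.
(* If [w = v], the complement weight of [u v] would be both [fsigma G u] and 0. *)
have neq_wv : w != v.
  apply: contraTneq u_gt0 => ewv; move: cmu_uw.
  by rewrite /= /cmu ewv (negPf neq_uv) fmu_uv sv minxx subrr => <-; rewrite ltxx.
have [vw|vw0] := ltP 0 (fmu G v w).
  suff : gamma_snR G < order_fg G by lra.
  by apply: (tight_gamma_snR_lt t1 uv (w := w)); rewrite ?fedgeE 1?eq_sym.
suff : gamma_snR (complement G) < order_fg G by lra.
apply: (tight_gamma_snR_lt t2 uw (w := v)); last by rewrite eq_sym.
(* With [fmu G v w <= 0], the complement weight of [w v] is at least [fsigma G u > 0]. *)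
by rewrite fedgeE /= /cmu (negPf neq_wv) sv sw minxx fmu_sym; lra.
Qed.

Theorem proposition3p15 (R : realFieldType) (V : finType)
    (G : fuzzyGraph R V) (hG : nontrivial G) (hGc : nontrivial (complement G)) :
  2 * (mu_min G + mu_min (complement G))
    <= gamma_snR G + gamma_snR (complement G)
    < 2 * order_fg G.
Proof.
rewrite (gamma_snR_complement_lt hG) andbT mulrDr.
by apply: lerD; apply: gamma_snR_ge.
Qed.
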